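(* Let $(H_n)_{n\in\mathbb N}$ be a sequence of Hilbert spaces and, for each $n\in\mathbb N$, let $\mathcal T_n=(T_n(t))_{t\ge0}\subset\mathcal L(H_n)$ be a semigroup. Assume that $\bigotimes_{n\in\mathbb N}\mathcal T_n$ is a $C_0$-semigroup on the complete infinite tensor product $H:=\bigotimes_{n\in\mathbb N}H_n$. Then, for every equivalence class $\mathcal A\in\Gamma$ of $C_0$-sequences, the corresponding incomplete tensor product $H_{\mathcal A}:=\bigotimes_{n\in\mathbb N}^{\mathcal A}H_n$ is invariant under $\bigotimes_{n\in\mathbb N}T_n(t)$ for all $t\ge0$. In particular, $\mathcal T_{\mathcal A}:=\bigotimes_{n\in\mathbb N}^{\mathcal A}\mathcal T_n$ is a well-defined $C_0$-semigroup on $H_{\mathcal A}$ that coincides with the restriction of $\bigotimes_{n\in\mathbb N}\mathcal T_n$ to $H_{\mathcal A}$, and $$\bigotimes_{n\in\mathbb N}\mathcal T_n=\bigoplus_{\mathcal A\in\Gamma}\mathcal T_{\mathcal A}$$ (with respect to the orthogonal decomposition $H=\bigoplus_{\mathcal A\in\Gamma}H_{\mathcal A}$).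
   Context: Hilbert spaces are complex; $\mathcal L(H)$ denotes the bounded operators on $H$. A semigroup is a family $(T(t))_{t\ge0}\subset\mathcal L(H)$ with $T(0)=I$ and $T(s+t)=T(s)T(t)$ (no measurability or continuity assumed); a $C_0$-semigroup is one that is strongly continuous on $[0,\infty)$. Products: for $(z_n)\subset\mathbb C$, $\prod_nz_n$ converges unconditionally to $a\in\mathbb C$ if $\lim_{N\to\infty}\prod_{n=1}^Nz_{\sigma(n)}=a$ for every bijection $\sigma:\mathbb N\to\mathbb N$. $\prod_nz_n$ is quasi-convergent if $\prod_n|z_n|$ converges unconditionally to a finite value; its value is then the unconditional limit of $\prod_nz_n$ if it exists and $0$ otherwise. Tensor products: $(h_n)\in\times_nH_n$ is a $C$-sequence if $\prod_n\|h_n\|$ converges unconditionally to a finite value. For a $C$-sequence $(h_n)$ the elementary tensor $\bigotimes_nh_n$ is the functional $(f_n)\mapsto\prod_n\langle h_n,f_n\rangle$ (quasi-convergent product) on the set of $C$-sequences. The complete tensor product $\bigotimes_nH_n$ is the completion of the linear span of elementary tensors with inner product determined by $\langle\bigotimes_nh_n,\bigotimes_nf_n\rangle=\prod_n\langle h_n,f_n\rangle$. A $C$-sequence is a $C_0$-sequence if $\sum_n|1-\|h_n\||<\infty$; two $C_0$-sequences are equivalent if $\sum_n|1-\langle h_n,f_n\rangle|<\infty$ (an equivalence relation); $\Gamma$ is the set of equivalence classes. For $\mathcal A\in\Gamma$, $\bigotimes_n^{\mathcal A}H_n$ is the closed linear span in $\bigotimes_nH_n$ of the $\bigotimes_nh_n$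 with $(h_n)\in\mathcal A$. The spaces $\bigotimes_n^{\mathcal A}H_n$, $\mathcal A\in\Gamma$, are mutually orthogonal with closed linear span $\bigotimes_nH_n$. For $A_n\in\mathcal L(H_n)$, the complete tensor product $\bigotimes_nA_n$ is well-defined if for every elementary tensor $\bigotimes_nh_n$ also $\bigotimes_nA_nh_n$ is an elementary tensor and $\bigotimes_nh_n\mapsto\bigotimes_nA_nh_n$ extends linearly to a bounded operator on $\bigotimes_nH_n$. $\bigotimes_n^{\mathcal A}A_n$ is well-defined (factorwise sense) if for every elementary tensor $\bigotimes_nh_n\in\bigotimes_n^{\mathcal A}H_n$, $\bigotimes_nA_nh_n$ is an elementary tensor in $\bigotimes_n^{\mathcal A}H_n$ and $\bigotimes_nh_n\mapsto\bigotimes_nA_nh_n$ extends linearly to a bounded operator on $\bigotimes_n^{\mathcal A}H_n$. Tensor products of semigroups are formed pointwise: $\bigotimes_n\mathcal T_n:=(\bigotimes_nT_n(t))_{t\ge0}$, $\bigotimes_n^{\mathcal A}\mathcal T_n:=(\bigotimes_n^{\mathcal A}T_n(t))_{t\ge0}$, and saying that such a family is a semigroup includes that the operators are well-defined for all $t\ge0$. *)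

(* Defs.v *)
From HB Require Import structures.
From mathcomp Require Import all_boot all_order all_algebra.
From mathcomp Require Import finmap sesquilinear.
From mathcomp Require Import all_classical all_reals all_analysis.
From mathcomp.analysis.showcase Require summability.

Set Implicit Arguments.
Unset Strict Implicit.
Unset Printing Implicit Defensive.

Import Order.TTheory GRing.Theory Num.Theory.
Import numFieldNormedType.Exports.

Local Open Scope classical_set_scope.
Local Open Scope ring_scope.

(* The scalar field C stands for the complex numbers R[i] over the reals R;
   keeping it abstract here lets the topology of C be inferred.  Norms of vectors
   live in C (as nonnegative reals).  The inner product is linear in its first
   argument and conjugate-linear in the second. *)
Record hilbertType (C : numClosedFieldType) := HilbertType {
  hilbert_sort :> completeNormedModType C;
  hdot : {dot hilbert_sort for Num.conj};
  hdot_norm : forall x : hilbert_sort, `|x| ^+ 2 = hdot x x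
}.

Definition lin_span (K : nzRingType) (V : lmodType K) (A : set V) : set V :=
  [set x | exists (m : nat) (c : 'I_m -> K) (v : 'I_m -> V),
     (forall i, A (v i)) /\ x = \sum_(i < m) c i *: v i].

(* Operators and semigroups on a subspace D of E are represented by functions
   E -> E of which only the values on D matter. *)
Section operators_on.
Context (R : realType) (C : numClosedFieldType) (E : normedModType C).
Implicit Types (D : set E) (S : E -> E) (T : R -> E -> E).

Definition bounded_operator_on D S : Prop :=
  [/\ forall x, D x -> D (S x),
      forall (a : C) x y, D x -> D y -> S (a *: x + y) = a *: S x + S y
    & exists M : C, forall x, D x -> `|S x| <= M * `|x| ].

Definition semigroup_on D T : Prop :=
  [/\ forall t, 0 <= t -> bounded_operator_on D (T t),
      forall x, D x -> T 0 x = x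
    & forall s t x, 0 <= s -> 0 <= t -> D x -> T (s + t) x = T s (T t x)].

Definition C0_semigroup_on D T : Prop :=
  semigroup_on D T /\
  forall x, D x -> {within `[0, +oo[, continuous (fun t : R => T t x)}.

End operators_on.

Section direct_sums.
Context (C : numClosedFieldType) (E : hilbertType C) (I : choiceType).
Implicit Types (x : I -> E) (K : I -> set E).

(* Unconditional sum: limit along the finite subsets of I *)
Definition has_sum x (y : E) : Prop :=
  summability.partial_sum x @ summability.totally --> y.

(* E is the orthogonal direct sum of the K i (which makes the components of a
   vector unique) and S acts componentwise as the T i. *)
Definition is_direct_sum_operator K (T : I -> E -> E) (S : E -> E) : Prop :=
  (forall i j (u v : E), i != j -> K i u -> K j v -> hdot E u v = 0) /\
  (forall y : E, exists x,
     [/\ forall i, K i (x i), has_sum x y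
       & has_sum (fun i => T i (x i)) (S y)]).

End direct_sums.

Section products.
Context (C : numClosedFieldType).
Implicit Types (z : nat -> C) (a : C).

Definition uncond_prod z a : Prop :=
  forall sigma : nat -> nat, bijective sigma ->
    \prod_(n < N) z (sigma n) @[N --> \oo] --> a.

(* Value of a quasi-convergent product: the unconditional limit, or 0 if there
   is none. *)
Definition qprod z : C := xget 0 [set a | uncond_prod z a].

End products.

Section sequences.
Context (C : numClosedFieldType) (H : nat -> hilbertType C).
Implicit Types h f : forall n, H n.

Definition is_cseq h : Prop := exists a, uncond_prod (fun n => `|h n|) a.

Definition is_c0seq h : Prop :=
  is_cseq h /\ cvgn (series (fun n => `|1 - `|h n| |)).

Definition c0equiv h f : Prop :=
  cvgn (series (fun n => `|1 - hdot (H n) (h n) (f n)|)).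

Definition Gamma : set (set (forall n, H n)) :=
  [set A | exists2 h, is_c0seq h & A = [set f | is_c0seq f /\ c0equiv h f]].

Record cseq := Cseq { cseq_val :> forall n, H n; cseqP : is_cseq cseq_val }.

Definition elementary h : cseq -> C :=
  fun f : cseq => qprod (fun n => hdot (H n) (h n) (f n)).

Definition algebraic_tensor : set (cseq -> C) :=
  lin_span [set elementary h | h in is_cseq].

(* A completion of the span of the elementary tensors: a Hilbert space with an
   isometric linear map of that span onto a dense subspace.  The values of
   [ct_embed] outside [algebraic_tensor] are irrelevant. *)
Record complete_tensor := CompleteTensor {
  ct_space :> hilbertType C;
  ct_embed : (cseq -> C) -> ct_space;
  ct_embed_linear : forall (a : C) u v,
    algebraic_tensor u -> algebraic_tensor v ->
    ct_embed (a *: u + v) = a *: ct_embed u + ct_embed v;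
  ct_embed_dot : forall h f, is_cseq h -> is_cseq f ->
    hdot ct_space (ct_embed (elementary h)) (ct_embed (elementary f)) =
    qprod (fun n => hdot (H n) (h n) (f n));
  ct_embed_dense : closure (ct_embed @` algebraic_tensor) = setT
}.

End sequences.

Section tensor_operators.
Context (C : numClosedFieldType) (H : nat -> hilbertType C) (E : complete_tensor H).
Implicit Types (D : set E) (A : forall n, H n -> H n).

Definition tens (h : forall n, H n) : E := ct_embed E (elementary h).

Definition incomplete_tensor (a : set (forall n, H n)) : set E :=
  closure (lin_span [set tens h | h in a]).

(* In the next four definitions D is setT for the complete tensor product and
   [incomplete_tensor a] for an incomplete one. *)
Definition tensor_extension D A (S : E -> E) : Prop :=
  bounded_operator_on D S /\
  forall h, is_cseq h -> D (tens h) -> S (tens h) = tens (fun n => A n (h n)).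

Definition tensor_well_defined D A : Prop :=
  (forall h, is_cseq h -> D (tens h) ->
     is_cseq (fun n => A n (h n)) /\ D (tens (fun n => A n (h n)))) /\
  exists S, tensor_extension D A S.

Definition tensor_op D A : E -> E :=
  xget (idfun : E -> E) [set S : E -> E | tensor_extension D A S].

Definition tensor_semigroup D (R : realType)
    (T : forall n, R -> H n -> H n) : R -> E -> E :=
  fun t => tensor_op D (fun n => T n t).

Definition is_tensor_C0_semigroup D (R : realType)
    (T : forall n, R -> H n -> H n) : Prop :=
  (forall t, 0 <= t -> tensor_well_defined D (fun n => T n t)) /\
  C0_semigroup_on D (tensor_semigroup D T).

End tensor_operators.

Arguments Gamma {C} H.
Arguments incomplete_tensor {C H} E a.
Arguments tensor_semigroup {C H} E D {R} T.
Arguments is_tensor_C0_semigroup {C H} E D {R} T.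

(* Main.v *)
Require Import Defs.
From mathcomp Require Import all_boot all_order all_algebra.
From mathcomp Require Import finmap ring.
From mathcomp Require Import all_classical all_reals all_analysis.
From mathcomp.real_closed Require Import complex.
From mathcomp.analysis.showcase Require summability.

(** Write S(t) for the tensor semigroup and H_a for the incomplete tensor
    product of a class a.  S(t) maps the elementary tensor of h to that of
    (T_n(t) h_n)_n, so an orbit that starts at an elementary tensor runs through
    elementary tensors.  Each of these is either in H_a or orthogonal to it
    ([tens_dichotomy]).  Hence, for h in a, the orbit of the elementary tensor of
    h takes values in the union of H_a and its orthogonal complement, two closed
    sets that meet only in 0.  If the orbit is nonzero at time t, then by the
    semigroup law it is nonzero on all of [0, t]; as it is continuous and [0, t]
    is connected, it cannot leave H_a, where it starts
    ([semigroup_tens_invariant]).  By linearity and boundedness S(t) leaves H_a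
    invariant.  A bounded operator on H_a is determined by its values on the
    elementary tensors of the sequences in a, so the factorwise operators on H_a
    are the restrictions of the S(t) and inherit the semigroup law and strong
    continuity.

    The dichotomy rests on two facts.  An unconditionally convergent product
    with nonzero value has factors z_n with summable |1 - z_n|
    ([uncond_prod_bounded_sums]).  Applied to the norms, this makes g a
    C_0-sequence as soon as its elementary tensor is nonzero; applied to the
    factors of an inner product of elementary tensors, it makes the two
    sequences equivalent as soon as that inner product is nonzero.  And
    equivalence of C_0-sequences is transitive ([c0equiv_trans]), so the second
    conclusion puts both sequences in one class.

    The dichotomy also shows that the H_a are mutually orthogonal with dense
    span.  Every vector is then the unconditional sum of its projections on the
    H_a ([orthogonal_decomposition]), and applying the bounded operator S(t)
    termwise gives the direct sum of the restrictions.

    All of this works over a scalar field in which nonnegative series with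
    bounded partial sums converge ([series_complete]); R[i] is one. *)

Set Implicit Arguments.
Unset Strict Implicit.
Unset Printing Implicit Defensive.

Import Order.TTheory GRing.Theory Num.Theory.
Import numFieldNormedType.Exports.

Local Open Scope classical_set_scope.
Local Open Scope ring_scope.

#[local] Existing Instance summability.totally_filter.

(** * Series with nonnegative terms *)

(** Completeness of the scalars enters through this property: C_0-sequences and
    their equivalence are defined by convergence of such series, while the
    estimates bound their partial sums. *)
Definition series_complete (C : numClosedFieldType) : Prop :=
  forall (u : nat -> C) (M : C),
    (forall n, 0 <= u n) -> (forall n, series u n <= M) -> cvgn (series u).

(** Reduces completeness to a statement about distances only, which can be
    checked on R[i] by comparing real parts. *)
Lemma dist_series_complete (C : numClosedFieldType) :
    (forall (u : nat -> C) (M : C),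
      (forall n, 0 <= u n) -> (forall n, series u n <= M) ->
      exists l, forall e, 0 < e -> \forall n \near \oo, `|l - series u n| < e) ->
  series_complete C.
Proof.
move=> H u M u0 uM; have [l ul] := H u M u0 uM.
by apply/cvg_ex; exists l; apply/cvgrPdist_lt.
Qed.

Lemma complex_series_complete (R : realType) : series_complete R[i].
Proof.
apply: dist_series_complete => u M u0 uM; pose s n := complex.Re (series u n).
have sE n : series u n = real_complex R (s n).
  by rewrite /s RRe_real// ger0_real// /series/= sumr_ge0.
have snd : nondecreasing_seq s.
  apply/nondecreasing_seqP => n; rewrite -lecR -!sE /series/= big_nat_recr//=.
  by rewrite lerDl.
have sub n : s n <= complex.Re M.
  by have := uM n; rewrite lecE => /andP[].
have /cvg_ex[/= l sl] : cvgn s.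
  apply: nondecreasing_is_cvgn => //.
  by exists (complex.Re M) => _ [n _ <-]; exact: sub.
exists (real_complex R l) => e e0.
have eE : e = real_complex R (complex.Re e) by rewrite RRe_real// gtr0_real.
have e0' : 0 < complex.Re e by rewrite -ltcR -eE.
move/cvgrPdist_lt : sl => /(_ _ e0'); apply: filterS => n.
rewrite sE -rmorphB/= normc_def/= expr0n/= addr0 sqrtr_sqr.
by rewrite [in X in _ -> X]eE ltcR.
Qed.

Lemma cvg_nneg_series_ub (C : numClosedFieldType) (u : nat -> C) :
  (forall n, 0 <= u n) -> cvgn (series u) -> exists M, forall n, series u n <= M.
Proof.
move=> u0 /cvg_ex[/= l /cvgrPdist_lt/(_ 1 ltr01)[N _ Nl]].
exists (`|l| + 1) => n.
have uN : series u n <= series u (n + N)%N.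
  rewrite /series/= (big_cat_nat (leq0n n) (leq_addr N n))/=.
  by rewrite lerDl sumr_ge0.
apply: (le_trans uN); rewrite -[leLHS]ger0_norm ?sumr_ge0//.
rewrite -[X in `|X|](subrK l); apply: le_trans (ler_normD _ _) _.
by rewrite addrC lerD2l distrC ltW// Nl//= leq_addl.
Qed.

(** * Unconditionally convergent products *)

(** Some enumeration of the naturals lists, infinitely often, a prefix [s]
    followed by the block [G s] chosen for it.  The prefixes [L k] are built
    greedily: append the block of the current prefix, then [k] if it has not
    occurred yet, which makes the enumeration surjective. *)
Lemma nat_enumeration (G : seq nat -> seq nat) :
    (forall s, uniq s -> uniq (s ++ G s)) ->
  exists sigma : nat -> nat, bijective sigma /\
    exists L : nat -> seq nat, forall k,
      [/\ (k <= size (L k))%N, L k = mkseq sigma (size (L k))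
        & L k ++ G (L k) = mkseq sigma (size (L k ++ G (L k)))].
Proof.
move=> uG.
pose next k s := let s' := s ++ G s in if k \in s' then s' else rcons s' k.
pose L := fix L k := if k is k'.+1 then next k' (L k') else [::].
have LS k : L k.+1 = next k (L k) by [].
have uL k : uniq (L k).
  elim: k => // k IH; rewrite LS /next; case: ifPn => kL; first exact: uG.
  by rewrite rcons_uniq kL uG.
have pG k : prefix (L k ++ G (L k)) (L k.+1).
  by rewrite LS /next; case: ifP => _; rewrite ?prefix_refl// prefix_rcons.
have pL k m : prefix (L k) (L (k + m)%N).
  elim: m => [|m IH]; first by rewrite addn0 prefix_refl.
  rewrite addnS; apply: prefix_trans IH _; apply: prefix_trans (pG _).
  exact: prefix_prefix.
have inL k : k \in L k.+1.
  rewrite LS /next; case: ifP => // _.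
  by rewrite mem_rcons mem_head.
have inL' j k : (j < k)%N -> j \in L k.
  move=> jk; have := pL j.+1 (k - j.+1)%N; rewrite subnKC// => /prefixP[s ->].
  by rewrite mem_cat inL.
have sL k : (k <= size (L k))%N.
  rewrite -{1}(size_iota 0 k); apply: uniq_leq_size (iota_uniq _ _) _ => j.
  by rewrite mem_iota /= add0n; exact: inL'.
have nthP s1 s2 n : prefix s1 s2 -> (n < size s1)%N -> nth 0%N s2 n = nth 0%N s1 n.
  by move=> /prefixP[s ->] ns; rewrite nth_cat ns.
pose sigma n := nth 0%N (L n.+1) n.
have sigmaE s k n : prefix s (L k) -> (n < size s)%N -> sigma n = nth 0%N s n.
  move=> ps ns; rewrite -(nthP _ _ _ ps ns) /sigma.
  have nk : (n < size (L k))%N by rewrite (leq_trans ns)// size_prefix.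
  rewrite -(nthP _ _ _ (pL n.+1 k))// -[in RHS](nthP _ _ _ (pL k n.+1))//.
  by rewrite addnC.
have mkE s k : prefix s (L k) -> s = mkseq sigma (size s).
  move=> ps; apply: (@eq_from_nth _ 0%N); first by rewrite size_mkseq.
  by move=> i si; rewrite nth_mkseq// (sigmaE _ _ _ ps).
exists sigma; split; last first.
  exists L => k; split => //; first exact: (mkE _ k (prefix_refl _)).
  exact: (mkE _ k.+1 (pG _)).
have sigI : injective sigma.
  move=> i j; set m := (maxn i j).+1.
  have si : (i < size (L m))%N by rewrite (leq_trans _ (sL m))// ltnS leq_maxl.
  have sj : (j < size (L m))%N by rewrite (leq_trans _ (sL m))// ltnS leq_maxr.
  rewrite (sigmaE _ _ _ (prefix_refl _) si) (sigmaE _ _ _ (prefix_refl _) sj).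
  by move/eqP; rewrite nth_uniq// => /eqP.
pose g m := index m (L m.+1).
have gK : cancel g sigma.
  move=> m; rewrite (sigmaE _ m.+1 _ (prefix_refl _)) ?nth_index//.
  by rewrite index_mem.
by exists g => //; exact: inj_can_sym.
Qed.

(** Otherwise every finite list can be followed by a disjoint block whose
    product stays at distance e from 1.  Along an enumeration that does so
    infinitely often, the partial products before and after the block differ by
    at least e times a factor that tends to |a|, so they cannot converge. *)
Lemma uncond_prod_cauchy (C : numClosedFieldType) (z : nat -> C) (a e : C) :
    uncond_prod z a -> a != 0 -> 0 < e ->
  exists N, forall G, uniq G -> {in G, forall n, (N <= n)%N} ->
    `|\prod_(i <- G) z i - 1| < e.
Proof.
move=> za a0 e0; apply: contrapT => /forallNP noN.
have badG (s : seq nat) : exists G, [/\ uniq G, {in G, forall n, n \notin s}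
    & e <= `|\prod_(i <- G) z i - 1| ].
  have /existsNP[G /not_implyP[uG /not_implyP[Gs Ge]]] :=
    noN (\max_(i <- s) i).+1.
  exists G; split=> //.
    move=> n /Gs; apply: contraTN => ns.
    by rewrite -leqNgt; exact: (@leq_bigmax_seq _ s xpredT id).
  by rewrite real_leNgt ?(gtr0_real e0) ?normr_real//; apply/negP.
have [G GP] := choice badG.
have [s us|sigma [sbij [L LP]]] := @nat_enumeration G.
  have [uG Gs _] := GP s; rewrite cat_uniq us uG andbT.
  by apply/hasPn => n /Gs.
(* d solves (|a| - d) * e = d + d: two partial products within d of a
   differ by less than 2 * d, while the bad block moves them apart by more than
   (|a| - d) * e. *)
pose d := e * `|a| / (2 + e).
have e2 : 0 < 2 + e by rewrite addr_gt0.
have d0 : 0 < d by rewrite divr_gt0 ?mulr_gt0 ?normr_gt0.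
have [N _ ad] : \forall n \near \oo, `|a - \prod_(i < n) z (sigma i)| < d.
  by have /cvgrPdist_lt := za _ sbij; exact.
have [LN LE LGE] := LP N.
have prodE s : s = mkseq sigma (size s) ->
    \prod_(i <- s) z i = \prod_(i < size s) z (sigma i).
  move=> sE; rewrite [in LHS]sE big_map -(big_mkord xpredT (fun i => z (sigma i))).
  by rewrite /index_iota subn0.
have := ad _ LN; rewrite /= -prodE//.
have /ad : (N <= size (L N ++ G (L N)))%N by rewrite size_cat (leq_trans LN)// leq_addr.
rewrite /= -prodE// big_cat/=; set Q := \prod_(i <- L N) _.
have [_ _] := GP (L N); set P := \prod_(i <- G _) _ => eP aQP aQ.
have QP : `|Q * (P - 1)| < d + d.
  have -> : Q * (P - 1) = (a - Q) - (a - Q * P) by ring.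
  by apply: le_lt_trans (ler_normB _ _) _; rewrite ltrD.
have Q0 : `|a| - d < `|Q|.
  rewrite ltrBlDr (le_lt_trans _ (_ : `|Q| + `|a - Q| < _))//; last by rewrite ltrD2l.
  by rewrite -[X in `|X| <= _](subrK Q) addrC ler_normD.
suff : (`|a| - d) * e < d + d.
  rewrite (_ : (`|a| - d) * e = d + d) ?ltxx// /d; field.
  by rewrite lt0r_neq0.
apply: le_lt_trans QP; rewrite normrM; apply: ler_pM => //; [|exact: ltW|exact: ltW].
rewrite ltW// subr_gt0 /d ltr_pdivrMr// mulrC ltr_pM2l ?normr_gt0//.
by rewrite ltrDr.
Qed.

(** If all finite products are within d of 1, multiplying one more factor z_i
    changes the product by z_i - 1 up to the relative error d; summing these
    changes bounds the sum of the z_i - 1 by a product minus 1. *)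
Lemma prod_sub1_sum_le (C : numClosedFieldType) (z : nat -> C) (d : C) (P : pred nat) :
    (forall G, uniq G -> all P G -> `|\prod_(i <- G) z i - 1| <= d) ->
  forall G, uniq G -> all P G ->
    `|\sum_(i <- G) (z i - 1)| <= d * (1 + \sum_(i <- G) `|z i - 1|).
Proof.
move=> zd G uG PG.
suff : `|\prod_(i <- G) z i - 1 - \sum_(i <- G) (z i - 1)| <=
       d * \sum_(i <- G) `|z i - 1|.
  move=> H; rewrite mulrDr mulr1.
  rewrite -[X in `|X| <= _](subKr (\prod_(i <- G) z i - 1)).
  by apply: le_trans (ler_normB _ _) _; apply: lerD => //; exact: zd.
elim: G uG PG => [|i G IH] /=; first by rewrite !big_nil !subrr normr0 mulr0.
move=> /andP[_ uG] /andP[_ PG]; rewrite !big_cons.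
set p := \prod_(i <- G) _; set s := \sum_(i <- G) _.
have -> : z i * p - 1 - (z i - 1 + s) = (p - 1) * (z i - 1) + (p - 1 - s) by ring.
apply: le_trans (ler_normD _ _) _; rewrite [leRHS]mulrDr lerD ?IH//.
by rewrite normrM ler_wpM2r// zd.
Qed.

(** The indices with nonnegative real part and the other ones give two sums
    without cancellation in the real part. *)
Lemma sum_normRe_le (C : numClosedFieldType) (w : nat -> C) (B : C) (G : seq nat) :
    (forall p : pred nat, `|\sum_(i <- G | p i) w i| <= B) ->
  \sum_(i <- G) `|'Re (w i)| <= 2 * B.
Proof.
move=> wB; pose p i := 0 <= 'Re (w i).
rewrite (bigID p)/= (eq_bigr (fun i => 'Re (w i))) => [|i pi]; last exact: ger0_norm.
rewrite [X in _ + X](eq_bigr (fun i => - 'Re (w i))) => [|i pi]; last first.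
  apply: ler0_norm; apply: ltW; move: pi.
  by rewrite /p -real_ltNge// Creal_Re.
rewrite sumrN -!raddf_sum mulr_natl mulr2n.
have Re_le (x : C) : `|'Re x| <= `|x| by have [] := leif_normC_Re_Creal x.
have Rel (x : C) : `|x| <= B -> `|'Re x| <= B by move=> xB; apply: le_trans xB.
apply: le_trans (real_ler_norm _) _.
  by rewrite rpredB// Creal_Re.
by apply: le_trans (ler_normB _ _) _; rewrite lerD// Rel.
Qed.

(** Real and imaginary parts each lose a factor 2; this is what turns bounds on
    all finite subsums into absolute summability. *)
Lemma sum_norm_le (C : numClosedFieldType) (w : nat -> C) (B : C) (G : seq nat) :
    (forall p : pred nat, `|\sum_(i <- G | p i) w i| <= B) ->
  \sum_(i <- G) `|w i| <= 4 * B.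
Proof.
move=> wB.
have ReB := sum_normRe_le wB.
have ImB : \sum_(i <- G) `|'Im (w i)| <= 2 * B.
  under eq_bigr => i _ do rewrite -normrN -ReMil.
  apply: sum_normRe_le => p; rewrite -mulr_sumr normrM normCi mul1r; exact: wB.
have -> : 4 * B = 2 * B + 2 * B by ring.
apply: le_trans (lerD ReB ImB); rewrite -big_split ler_sum// => i _.
rewrite {1}[w i]Crect; apply: le_trans (ler_normD _ _) _.
by rewrite normrM normCi mul1r.
Qed.

(** Far enough out, all finite products are within 1/8 of 1.  With s the sum of
    |z_i - 1| over a finite set of such indices, [prod_sub1_sum_le] and [sum_norm_le]
    give s <= 4 * (1/8) * (1 + s), hence s <= 1. *)
Lemma uncond_prod_bounded_sums (C : numClosedFieldType) (z : nat -> C) (a : C) :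
    uncond_prod z a -> a != 0 ->
  exists M, forall n, series (fun n => `|1 - z n|) n <= M.
Proof.
move=> za a0; have e8 : 0 < 8^-1 :> C by rewrite invr_gt0.
have [N zN] := uncond_prod_cauchy za a0 e8.
have small G : uniq G -> all (leq N) G -> `|\prod_(i <- G) z i - 1| <= 8^-1.
  by move=> uG /allP GN; exact/ltW/zN.
have sumG G : uniq G -> all (leq N) G -> \sum_(i <- G) `|z i - 1| <= 1.
  move=> uG GN; set s := \sum_(i <- G) _.
  have : s <= 4 * (8^-1 * (1 + s)).
    apply: sum_norm_le => p; rewrite -big_filter.
    apply: le_trans (prod_sub1_sum_le small _ _) _; first exact: filter_uniq.
      by apply/allP => i; rewrite mem_filter => /andP[_]; exact: allP.
    rewrite ler_pM2l// lerD2l big_filter /s [leRHS](bigID p)/= lerDl.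
    by rewrite sumr_ge0.
  have -> : 4 * (8^-1 * (1 + s)) = (1 + s) / 2 by field.
  by rewrite ler_pdivlMr// mulrDr mulr1 lerD2r.
exists (series (fun n => `|1 - z n|) N + 1) => n.
have uN : series (fun n => `|1 - z n|) n <= series (fun n => `|1 - z n|) (N + n)%N.
  rewrite /series/= (big_cat_nat (leq0n n) (leq_addl N n))/=.
  by rewrite lerDl sumr_ge0.
apply: (le_trans uN); rewrite /series/= (big_cat_nat (leq0n N) (leq_addr n N))/=.
rewrite lerD2l; under eq_bigr => i _ do rewrite distrC.
apply: sumG; first exact: iota_uniq.
by apply/allP => i; rewrite mem_index_iota => /andP[].
Qed.

(** * Geometry of the inner product *)

Section hilbert_dot.
Context (C : numClosedFieldType) (E : hilbertType C).
Implicit Types x y : E.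
Local Notation "<< x , y >>" := (hdot E x y).

Lemma hdotC x y : << x, y >> = Num.conj << y, x >>.
Proof. by rewrite hermC expr0 mul1r. Qed.

Lemma hdot_eq0C x y : << x, y >> = 0 -> << y, x >> = 0.
Proof. by move=> xy; rewrite hdotC xy rmorph0. Qed.

Lemma norm_pythagoras x y : << x, y >> = 0 -> `|x + y| ^+ 2 = `|x| ^+ 2 + `|y| ^+ 2.
Proof. by move=> xy; rewrite !hdot_norm hnormDd. Qed.

(** Cauchy-Schwarz: Pythagoras applied to the component of x along y. *)
Lemma hdot_le_norm x y : `|<< x, y >>| <= `|x| * `|y|.
Proof.
have [->|y0] := eqVneq y 0; first by rewrite linear0r normr0 mulr_ge0.
have yy0 : `|y| ^+ 2 != 0 by rewrite expf_eq0/= normr_eq0.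
pose a := << x, y >> / `|y| ^+ 2; pose x1 := x - a *: y.
have ox : << x1, a *: y >> = 0.
  by rewrite linearZr_LR/= linearBl/= linearZl_LR/= -hdot_norm divfK// subrr mulr0.
have aE : `|a *: y| = `|<< x, y >>| / `|y|.
  rewrite normrZ normrM normfV normrX normr_id expr2 invfM mulrA mulfVK//.
  by rewrite normr_eq0.
have : `|a *: y| ^+ 2 <= `|x| ^+ 2.
  by rewrite -[x](subrK (a *: y)) norm_pythagoras// lerDr exprn_ge0.
by rewrite ler_pXn2r ?nnegrE// aE ler_pdivrMr// normr_gt0.
Qed.

End hilbert_dot.

(** * Equivalence of C_0-sequences *)

Section bounded_sums.
Context (C : numClosedFieldType).
Implicit Types u v : nat -> C.

Definition bounded_sums u : Prop := exists M, forall n, series u n <= M.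

Lemma bounded_sums_le u v :
  (forall n, u n <= v n) -> bounded_sums v -> bounded_sums u.
Proof.
move=> uv [M vM]; exists M => n; apply: le_trans (vM n).
by apply: ler_sum => i _; exact: uv.
Qed.

Lemma bounded_sumsD u v : bounded_sums u -> bounded_sums v ->
  bounded_sums (fun n => u n + v n).
Proof.
move=> [M uM] [N vN]; exists (M + N) => n.
by rewrite /series/= big_split; exact: lerD (uM n) (vN n).
Qed.

Lemma bounded_sumsZ (c : C) u : 0 <= c -> bounded_sums u ->
  bounded_sums (fun n => c * u n).
Proof.
move=> c0 [M uM]; exists (c * M) => n.
by rewrite /series/= -mulr_sumr; exact: ler_wpM2l c0 _ _ (uM n).
Qed.

Lemma bounded_sums_term u : (forall n, 0 <= u n) -> bounded_sums u ->
  exists M, forall n, u n <= M.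
Proof.
move=> u0 [M uM]; exists M => n; apply: le_trans (uM n.+1).
by rewrite /series/= big_nat_recr//= lerDr sumr_ge0.
Qed.

Lemma cvg_seriesP u : series_complete C -> (forall n, 0 <= u n) ->
  cvgn (series u) <-> bounded_sums u.
Proof.
move=> sc u0; split; first exact: cvg_nneg_series_ub.
by case=> M; exact: sc.
Qed.

(** A quasi-convergent product defaults to 0, so a nonzero value is a genuine
    unconditional limit. *)
Lemma qprod_bounded_sums (z : nat -> C) :
  qprod z != 0 -> bounded_sums (fun n => `|1 - z n|).
Proof.
rewrite /qprod; case: xgetP => [a _ za a0|_]; last by rewrite eqxx.
exact: uncond_prod_bounded_sums za a0.
Qed.

End bounded_sums.

Section c0_sequences.
Context (C : numClosedFieldType) (H : nat -> hilbertType C).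
Context (sc : series_complete C).
Implicit Types h f g : forall n, H n.

Local Notation near1 h f := (fun n => `|1 - hdot (H n) (h n) (f n)|).

Lemma c0equivP h f : c0equiv h f <-> bounded_sums (near1 h f).
Proof. exact: cvg_seriesP. Qed.

Lemma c0equiv_sym h f : c0equiv h f -> c0equiv f h.
Proof.
suff near1C : near1 h f = near1 f h by rewrite /c0equiv near1C.
apply/funext => n.
by rewrite hdotC -[X in X - _](rmorph1 Num.conj) -rmorphB norm_conjC.
Qed.

(** 1 - |h_n|^2 = (1 - |h_n|)(1 + |h_n|), and the norms |h_n| are bounded because
    the |1 - |h_n|| are. *)
Lemma c0seq_equiv_refl h : is_c0seq h -> c0equiv h h.
Proof.
move=> [_ /(cvg_seriesP sc (fun=> normr_ge0 _)) hb]; apply/c0equivP.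
have [M hM] := bounded_sums_term (fun=> normr_ge0 _) hb.
have M0 : 0 <= M by apply: le_trans (hM 0%N).
apply: bounded_sums_le (bounded_sumsZ (_ : 0 <= 2 + M) hb); last exact: addr_ge0.
move=> n; rewrite -hdot_norm -[X in X - _](expr1n _ 2) subr_sqr normrM mulrC.
rewrite ler_wpM2r// (_ : 1 + `|h n| = 2 - (1 - `|h n|)); last by ring.
apply: le_trans (ler_normB _ _) _; rewrite lerD// ger0_norm//.
Qed.

(** |1 - |h_n|| <= |1 - |h_n|^2| as the other factor 1 + |h_n| is at least 1. *)
Lemma c0seq_of_qprod h : is_cseq h ->
  qprod (fun n => hdot (H n) (h n) (h n)) != 0 -> is_c0seq h.
Proof.
move=> ch /qprod_bounded_sums hb; split=> //.
apply/(cvg_seriesP sc (fun=> normr_ge0 _)); apply: bounded_sums_le hb => n.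
rewrite -hdot_norm -[X in _ <= `|X - _|](expr1n _ 2) subr_sqr normrM.
by rewrite ler_peMr// ger0_norm ?addr_ge0// lerDl.
Qed.

(** The identity
    1 - <h,g> = (1 - <h,f>) + (1 - <f,g>) - (1 - <f,f>) - <h - f, g - f>
    reduces the claim to the summability of |h_n - f_n|^2 and |g_n - f_n|^2, and
    the square of a distance expands into four terms of the form 1 - <x,y>. *)
Lemma c0equiv_trans h f g : is_c0seq h -> is_c0seq f -> is_c0seq g ->
  c0equiv h f -> c0equiv f g -> c0equiv h g.
Proof.
move=> /c0seq_equiv_refl/c0equivP hh /c0seq_equiv_refl/c0equivP ff.
move=> /c0seq_equiv_refl/c0equivP gg hf' fg'.
have /c0equivP fh := c0equiv_sym hf'; have /c0equivP gf := c0equiv_sym fg'.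
move: hf' fg' => /c0equivP hf /c0equivP fg.
have dist2 (x y : forall n, H n) :
    bounded_sums (near1 x x) -> bounded_sums (near1 y y) ->
    bounded_sums (near1 x y) -> bounded_sums (near1 y x) ->
  bounded_sums (fun n => `|x n - y n| ^+ 2).
  move=> xx yy xy yx.
  apply: bounded_sums_le (bounded_sumsD (bounded_sumsD xx yy) (bounded_sumsD xy yx)).
  move=> n; rewrite -[leLHS]ger0_norm ?exprn_ge0// hdot_norm linearBl/= !linearBr/=.
  set a := hdot _ (x n) (x n); set b := hdot _ (x n) (y n).
  set c := hdot _ (y n) (x n); set d := hdot _ (y n) (y n).
  have -> : a - b - (c - d) = (1 - b) + (1 - c) - ((1 - a) + (1 - d)) by ring.
  apply: le_trans (ler_normB _ _) _; rewrite addrC.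
  by apply: lerD; exact: ler_normD.
have d1 := dist2 _ _ hh ff hf fh; have d2 := dist2 _ _ gg ff gf fg.
apply/c0equivP.
apply: bounded_sums_le (bounded_sumsD (bounded_sumsD hf fg)
  (bounded_sumsD ff (bounded_sumsD d1 d2))) => n.
pose p := hdot (H n) (h n - f n) (g n - f n).
have -> : 1 - hdot (H n) (h n) (g n) = (1 - hdot (H n) (h n) (f n)) +
    (1 - hdot (H n) (f n) (g n)) - ((1 - hdot (H n) (f n) (f n)) + p).
  by rewrite /p linearBl/= !linearBr/=; ring.
apply: le_trans (ler_normB _ _) _; apply: lerD; first exact: ler_normD.
apply: le_trans (ler_normD _ _) _; rewrite lerD2l.
apply: le_trans (hdot_le_norm _ _) _.
set s := `|h n - f n|; set t := `|g n - f n|.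
have [s0 t0] : 0 <= s /\ 0 <= t by rewrite !normr_ge0.
have : 0 <= (s - t) ^+ 2 + (s ^+ 2 + t ^+ 2).
  apply: addr_ge0; last by rewrite addr_ge0// exprn_ge0.
  by rewrite real_exprn_even_ge0// rpredB// ger0_real.
have -> : (s - t) ^+ 2 + (s ^+ 2 + t ^+ 2) = 2 * (s ^+ 2 + t ^+ 2 - s * t) by ring.
by rewrite pmulr_rge0// subr_ge0.
Qed.

End c0_sequences.

(** * Closed subspaces and orthogonal sums *)

Section normed_closure.
Context (C : numClosedFieldType) (E : normedModType C).
Implicit Types (A : set E) (x y : E).

Lemma closure_normP A x :
  closure A x <-> forall e, 0 < e -> exists2 y, A y & `|x - y| < e.
Proof.
split=> [Ax e e0|Ax B /nbhs_ballP[e /= e0 xeB]].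
  have [y [Ay]] := Ax _ (nbhsx_ballx x e e0).
  by rewrite -ball_normE/= => xy; exists y.
have [y Ay xy] := Ax e e0; exists y; split=> //.
by apply: xeB; rewrite -ball_normE.
Qed.

Lemma closed_normP A :
  (forall x, (forall e, 0 < e -> exists2 y, A y & `|x - y| < e) -> A x) -> closed A.
Proof. by move=> H x /closure_normP; exact: H. Qed.

End normed_closure.

Lemma le_eps_eq0 (C : numFieldType) (V : normedZmodType C) (x : V) (M : C) :
  (forall e, 0 < e -> `|x| <= M * e) -> x = 0.
Proof.
move=> xM; have M0 : 0 <= M by rewrite -[M]mulr1 (le_trans _ (xM 1 _)).
apply/eqP; apply: contraT => x0.
have nx : 0 < `|x| by rewrite normr_gt0.
have M1 : 0 < M + 1 by rewrite ltr_wpDl.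
have := xM (`|x| / (M + 1)) (divr_gt0 nx M1).
rewrite mulrA ler_pdivlMr// mulrC ler_pM2r//.
by rewrite -lerBrDl subrr ler10.
Qed.

Section linear_sets.
Context (F : nzRingType) (V : lmodType F).
Implicit Types (A K : set V) (x y : V).

Definition linear_set K : Prop :=
  K 0 /\ forall (a : F) x y, K x -> K y -> K (a *: x + y).

Lemma linear_setT : linear_set (setT : set V). Proof. by []. Qed.

Lemma linear_setD K x y : linear_set K -> K x -> K y -> K (x + y).
Proof. by move=> [_ Kl] Kx Ky; rewrite -[x]scale1r; exact: Kl. Qed.

Lemma linear_setZ K a x : linear_set K -> K x -> K (a *: x).
Proof. by move=> [K0 Kl] Kx; rewrite -[_ *: _]addr0; exact: Kl. Qed.

Lemma linear_setB K x y : linear_set K -> K x -> K y -> K (x - y).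
Proof.
by move=> lK Kx Ky; apply: linear_setD => //; rewrite -scaleN1r; exact: linear_setZ.
Qed.

Lemma linear_set_sum K (I : Type) (r : seq I) (P : pred I) (f : I -> V) :
  linear_set K -> (forall i, P i -> K (f i)) -> K (\sum_(i <- r | P i) f i).
Proof.
move=> lK Kf; elim/big_ind : _ => //; first by case: lK.
by move=> x y; exact: linear_setD.
Qed.

Lemma lin_span_linear A : linear_set (lin_span A).
Proof.
split; first by exists 0%N, (fun=> 0), (fun=> 0); split=> [[]//|]; rewrite big_ord0.
move=> a _ _ [m [c [v [Av ->]]]] [n [d [w [Aw ->]]]].
exists (m + n)%N,
  (fun k => match fintype.split k with inl i => a * c i | inr j => d j end),
  (fun k => match fintype.split k with inl i => v i | inr j => w j end); split.
  by move=> k; case: (fintype.split k).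
rewrite big_split_ord/= scaler_sumr; congr (_ + _); apply: eq_bigr => i _.
  by rewrite (unsplitK (inl i)) scalerA.
by rewrite (unsplitK (inr i)).
Qed.

Lemma sub_lin_span A : A `<=` lin_span A.
Proof.
move=> x Ax; exists 1%N, (fun=> 1), (fun=> x); split=> //.
by rewrite big_ord1 scale1r.
Qed.

Lemma lin_span_min A K : linear_set K -> A `<=` K -> lin_span A `<=` K.
Proof.
move=> lK AK _ [m [c [v [Av ->]]]]; apply: linear_set_sum => // i _.
exact/(linear_setZ _ lK)/AK.
Qed.

End linear_sets.

Section closed_spans.
Context (C : numClosedFieldType) (E : normedModType C).
Implicit Types (A K : set E) (x y : E).

Lemma closure_linear K : linear_set K -> linear_set (closure K).
Proof.
move=> [K0 Kl]; split; first exact: subset_closure.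
move=> a x y /closure_normP Kx /closure_normP Ky; apply/closure_normP => e e0.
have e2 : 0 < e / 2 by rewrite divr_gt0.
have a1 : 0 < `|a| + 1 by rewrite ltr_wpDl.
have [x' Kx' xx'] := Kx (e / 2 / (`|a| + 1)) (divr_gt0 e2 a1).
have [y' Ky' yy'] := Ky _ e2.
exists (a *: x' + y'); first exact: Kl.
rewrite opprD addrACA -scalerBr [e]splitr; apply: le_lt_trans (ler_normD _ _) _.
apply: ler_ltD => //; rewrite normrZ.
apply: le_trans (_ : (`|a| + 1) * `|x - x'| <= _); first by rewrite ler_wpM2r// lerDl.
by rewrite mulrC -ler_pdivlMr// ltW.
Qed.

Lemma closed_span_linear A : linear_set (closure (lin_span A)).
Proof. exact/closure_linear/lin_span_linear. Qed.

Lemma sub_closed_span A : A `<=` closure (lin_span A).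
Proof. by move=> x /sub_lin_span; exact: subset_closure. Qed.

Lemma closed_span_min A K :
  linear_set K -> closed K -> A `<=` K -> closure (lin_span A) `<=` K.
Proof.
move=> lK cK AK x /(closureS (lin_span_min lK AK)).
by rewrite -(closure_id K).1.
Qed.

End closed_spans.

Section orthogonality.
Context (C : numClosedFieldType) (E : hilbertType C).
Implicit Types (A K : set E) (x y : E).

Definition orthocomp A : set E := [set x | forall y, A y -> hdot E x y = 0].

Lemma orthocomp_linear A : linear_set (orthocomp A).
Proof.
split=> [y Ay|a x y xA yA z Az]; first by rewrite linear0l.
by rewrite linearDl/= linearZl_LR/= xA// yA// mulr0 addr0.
Qed.

Lemma orthocomp_closed A : closed (orthocomp A).
Proof.
apply: closed_normP => x xA z Az; apply: (@le_eps_eq0 _ _ _ `|z|) => e e0.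
have [y yA xy] := xA e e0.
rewrite -[x](subrK y) linearDl/= (yA z Az) addr0 mulrC.
by apply: le_trans (hdot_le_norm _ _) _; rewrite ler_wpM2r// ltW.
Qed.

Lemma orthocomp_closed_span A : orthocomp A `<=` orthocomp (closure (lin_span A)).
Proof.
move=> x xA y Ay; apply: hdot_eq0C; move: y Ay.
suff : closure (lin_span A) `<=` orthocomp [set x] by move=> + y Ay => /(_ y Ay); exact.
apply: closed_span_min; [exact: orthocomp_linear|exact: orthocomp_closed|].
by move=> y Ay _ ->; exact/hdot_eq0C/xA.
Qed.

Definition is_projection K y p : Prop := K p /\ orthocomp K (y - p).

(** The difference of the residues is orthogonal to K, so Pythagoras applies. *)
Lemma projection_contract K y z p q : linear_set K ->
  is_projection K y p -> is_projection K z q -> `|p - q| <= `|y - z|.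
Proof.
move=> lK [Kp yp] [Kq zq].
have Kpq : K (p - q) by exact: linear_setB.
have o : hdot E ((y - p) - (z - q)) (p - q) = 0.
  by rewrite linearBl/= yp// zq// subrr.
rewrite -ler_sqr ?nnegrE//.
have pq : y - p - (z - q) = (y - z) - (p - q).
  by rewrite !opprB [q - z]addrC addrACA [- p + q]addrC.
have -> : y - z = (y - p - (z - q)) + (p - q) by rewrite pq subrK.
by rewrite (norm_pythagoras o) lerDr exprn_ge0.
Qed.

Lemma projection_unique K y p q : linear_set K ->
  is_projection K y p -> is_projection K y q -> p = q.
Proof.
move=> lK yp yq; apply/eqP; rewrite -subr_eq0 -normr_le0.
by rewrite (le_trans (projection_contract lK yp yq))// subrr normr0.
Qed.

Lemma projection_linear K a y z p q : linear_set K ->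
  is_projection K y p -> is_projection K z q ->
  is_projection K (a *: y + z) (a *: p + q).
Proof.
move=> lK [Kp yp] [Kq zq]; split; first exact: lK.2.
by rewrite opprD addrACA -scalerBr; apply: (orthocomp_linear K).2.
Qed.

(** Projections of nearby vectors are near each other, so as y approaches x
    inside this set its projections form a Cauchy filter; the limit is the
    projection of x.  Together with linearity this yields projections for every
    vector of a closed span once the spanning vectors have them. *)
Lemma projection_closed K : linear_set K -> closed K ->
  closed [set y | exists p, is_projection K y p].
Proof.
move=> lK cK x Px; set P := [set y | _] in Px *.
have /choice[p pP] (y : E) : exists p, P y -> is_projection K y p.
  by have [[q qP]|nP] := pselect (P y); [exists q|exists 0].
pose F := p @ within P (nbhs x).
have PF : ProperFilter (within P (nbhs x)) by exact: within_nbhs_proper.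
have near_x e : 0 < e -> within P (nbhs x) [set y | P y /\ `|x - y| < e].
  move=> e0; have := nbhsx_ballx x e e0; rewrite -ball_normE.
  by apply: filterS => y xy Py.
have Fc : cauchy F.
  apply: cauchy_exP => e e0; have e2 : 0 < e / 2 by rewrite divr_gt0.
  move/closure_normP : Px => /(_ _ e2)[y0 Py0 xy0]; exists (p y0).
  apply: filterS (near_x _ e2) => y [Py xy] /=; rewrite -ball_normE/=.
  apply: le_lt_trans (projection_contract lK (pP _ Py0) (pP _ Py)) _.
  by rewrite [e]splitr -(subrKA x) (le_lt_trans (ler_normD _ _))// ltrD// distrC.
have /cvg_ex[/= l Fl] : cvg F by exact: cauchy_cvg.
have approx e : 0 < e -> exists y, [/\ P y, `|x - y| < e & `|l - p y| < e].
  move=> e0; have /cvgrPdist_lt/(_ e e0) nl := Fl.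
  have [y [[Py xy] ly]] := filter_ex (filterI (near_x _ e0) nl).
  by exists y.
exists l; split.
  apply/cK/closure_normP => e /approx[y [/pP[Kpy _] _ ly]].
  by exists (p y).
move=> v Kv; apply: (@le_eps_eq0 _ _ _ (2 * `|v|)) => e /approx[y [Py xy ly]].
have [Kpy /(_ v Kv) yv] := pP _ Py.
have -> : x - l = (x - y) + ((y - p y) - (l - p y)).
  by rewrite opprB addrA subrKA addrA subrK.
rewrite linearDl/= [X in _ + X]linearBl/= yv sub0r; apply: le_trans (ler_normB _ _) _.
rewrite -mulrA mulr_natl mulr2n mulrC; apply: lerD.
  by apply: le_trans (hdot_le_norm _ _) _; rewrite ler_wpM2r// ltW.
by apply: le_trans (hdot_le_norm _ _) _; rewrite ler_wpM2r// ltW.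
Qed.

End orthogonality.

Section orthogonal_sums.
Context (C : numClosedFieldType) (E : hilbertType C) (I : choiceType).
Context (K : I -> set E) (K_linear : forall i, linear_set (K i)).
Context (K_closed : forall i, closed (K i)).
Context (K_ortho : forall i j, i != j -> K j `<=` orthocomp (K i)).
Context (K_total : closure (lin_span (\bigcup_i K i)) = setT).

(** A vector of K_i is its own projection on K_i, and a vector of any other K_j
    projects to 0; by linearity and closedness this extends to the closed span. *)
Lemma exists_projection i y : exists p, is_projection (K i) y p.
Proof.
suff /(_ y) : setT `<=` [set y | exists p, is_projection (K i) y p] by exact.
rewrite -K_total; apply: closed_span_min; [|exact: projection_closed|].
  split=> [|a u v [p up] [q vq]].
    exists 0; split; first exact: (K_linear i).1.
    by rewrite subrr; exact: (orthocomp_linear _).1.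
  by exists (a *: p + q); exact: projection_linear.
move=> x [j _ Kjx]; have [ij|ij] := eqVneq i j.
  exists x; split; first by rewrite ij.
  by rewrite subrr; exact: (orthocomp_linear _).1.
exists 0; split; first exact: (K_linear i).1.
by rewrite subr0; exact: K_ortho ij _ Kjx.
Qed.

(** Bessel: y minus a partial sum is orthogonal to that partial sum. *)
Lemma partial_sum_projection_le (x : I -> E) y (J : {fset I}) :
  (forall i, is_projection (K i) y (x i)) ->
  `|summability.partial_sum x J| <= `|y|.
Proof.
move=> xP; set s := summability.partial_sum x J.
have ys : hdot E (y - s) s = 0.
  have sE : s = \sum_(i : J) x (val i) by [].
  rewrite [X in hdot E _ X]sE linear_sumr/= big1// => j _.
  rewrite sE (bigD1 j)//= opprD addrA linearBl/=.
  have [Kj yj] := xP (val j).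
  rewrite yj// sub0r linear_sumlz big1 ?oppr0// => i ij.
  apply: (K_ortho _ (xP (val i)).1 Kj).
  by apply: contraNneq ij => ji; apply/eqP/val_inj.
rewrite -ler_sqr ?nnegrE//.
by rewrite -[in leRHS](subrK s y) (norm_pythagoras ys) lerDr exprn_ge0.
Qed.

(** The vectors that are the sum of their projections form a closed subspace
    containing every K_i.  Closedness is an e/3 argument: by the Bessel bound,
    the partial sums of the projections of z - w stay as small as z - w. *)
Lemma orthogonal_decomposition y :
  exists x : I -> E, (forall i, K i (x i)) /\ has_sum x y.
Proof.
have [p pP] : exists p : E -> I -> E, forall y i, is_projection (K i) y (p y i).
  have /choice[p pP] (z : E) : exists x : I -> E, forall i, is_projection (K i) z (x i).
    by have /choice[x xP] := exists_projection^~ z; exists x.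
  by exists p.
suff : setT `<=` [set y | has_sum (p y) y].
  by move=> /(_ y Logic.I) pyy; exists (p y); split=> // i; case: (pP y i).
have p_lin a u v : p (a *: u + v) = a *: p u + p v.
  apply/funext => i; apply: (projection_unique (K_linear i) (pP _ i)).
  exact: projection_linear.
have p_sum a u v (J : {fset I}) : summability.partial_sum (p (a *: u + v)) J =
    a *: summability.partial_sum (p u) J + summability.partial_sum (p v) J.
  rewrite p_lin /summability.partial_sum scaler_sumr -big_split.
  by apply: eq_bigr.
rewrite -K_total; apply: closed_span_min.
- split=> [|a u v up vp].
    rewrite /has_sum/=; have -> : p 0 = fun=> 0.
      apply/funext => i; apply: (projection_unique (K_linear i) (pP _ i)).
      split; first exact: (K_linear i).1.
      by rewrite subrr; exact: (orthocomp_linear _).1.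
    rewrite (_ : summability.partial_sum _ = fun=> 0); first exact: cvg_cst.
    by apply/funext => J; rewrite /summability.partial_sum big1.
  rewrite /has_sum/=.
  rewrite (_ : summability.partial_sum _ = fun J =>
    a *: summability.partial_sum (p u) J + summability.partial_sum (p v) J).
    by apply: cvgD => //; exact: cvgZr.
  by apply/funext => J; exact: p_sum.
- apply: closed_normP => z zA; apply/cvgrPdist_lt => e e0.
  have e3 : 0 < e / 3 by rewrite divr_gt0.
  have [w /cvgrPdist_lt/(_ _ e3) wA zw] := zA _ e3.
  apply: filterS wA => J wJ.
  have -> : z - summability.partial_sum (p z) J = (z - w) +
     ((w - summability.partial_sum (p w) J) - summability.partial_sum (p (z - w)) J).
    have -> : summability.partial_sum (p z) J =
        summability.partial_sum (p (z - w)) J + summability.partial_sum (p w) J.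
      by rewrite -[X in p X](subrK w z) -[X in p (X + _)]scale1r p_sum scale1r.
    by rewrite -[w - _ - _]addrA [RHS]addrA subrK opprD [X in z + X]addrC.
  have -> : e = e / 3 + (e / 3 + e / 3) by field.
  apply: le_lt_trans (ler_normD _ _) _; apply: ltrD => //.
  apply: le_lt_trans (ler_normB _ _) _; apply: ltrD => //.
  by apply: le_lt_trans (partial_sum_projection_le _ (pP _)) _.
- move=> z [j _ Kjz]; have pz i : p z i = if i == j then z else 0.
    apply: (projection_unique (K_linear i) (pP z i)); case: eqVneq => [->|ij].
      by split=> //; rewrite subrr; exact: (orthocomp_linear _).1.
    split; first exact: (K_linear i).1.
    by rewrite subr0; exact: K_ortho ij _ Kjz.
  apply: cvg_near_cst; exists [fset j]%fset => // J/= jJ.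
  have jJ' : j \in J by rewrite (fsubsetP jJ)// in_fset1.
  rewrite /summability.partial_sum (bigD1 [` jJ']%fset)//= pz eqxx big1 ?addr0// => i ij.
  by rewrite pz; case: eqVneq => // ij'; rewrite -val_eqE/= ij' eqxx in ij.
Qed.

End orthogonal_sums.

(** * Elementary tensors and their classes *)

Section tensors.
Context (C : numClosedFieldType) (H : nat -> hilbertType C) (E : complete_tensor H).
Context (sc : series_complete C).
Implicit Types (h f g : forall n, H n) (a b : set (forall n, H n)).

(** The embedding is linear on the algebraic tensor product, so it maps the
    latter into the span of the embedded elementary tensors. *)
Lemma tens_dense : closure (lin_span [set tens E h | h in @is_cseq C H]) = setT.
Proof.
have atl : linear_set (@algebraic_tensor C H) by exact: lin_span_linear.
rewrite -subTset -(ct_embed_dense E); apply: closureS => _ [u uA <-].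
suff : @algebraic_tensor C H `<=` [set v | algebraic_tensor v /\
    lin_span [set tens E h | h in @is_cseq C H] (ct_embed E v)].
  by move=> /(_ u uA)[].
apply: lin_span_min.
  split=> [|c v w [Av sv] [Aw sw]].
    split; first exact: atl.1.
    have -> : ct_embed E (0 : cseq H -> C) = 0.
      have := ct_embed_linear E (-1) atl.1 atl.1.
      by rewrite scaleN1r addNr scaleN1r addNr.
    exact: (lin_span_linear _).1.
  split; first exact: atl.2.
  by rewrite ct_embed_linear//; exact: (lin_span_linear _).2.
move=> _ [h ch <-]; split; first by apply: sub_lin_span; exists h.
by apply: sub_lin_span; exists h.
Qed.

Lemma c0seq_of_tens g : is_cseq g -> tens E g != 0 -> is_c0seq g.
Proof.
move=> cg g0; apply: c0seq_of_qprod => //.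
by rewrite -(ct_embed_dot E)// -hdot_norm expf_eq0/= normr_eq0.
Qed.

Lemma c0equiv_of_hdot_tens h f : is_cseq h -> is_cseq f ->
  hdot E (tens E h) (tens E f) != 0 -> c0equiv h f.
Proof.
by move=> ch cf; rewrite ct_embed_dot// => /qprod_bounded_sums/c0equivP; exact.
Qed.

Lemma Gamma_c0seq a h : Gamma H a -> a h -> is_c0seq h.
Proof. by move=> [k _ ->] []. Qed.

Lemma Gamma_equiv a h f : Gamma H a -> a h -> is_c0seq f -> c0equiv h f -> a f.
Proof.
move=> [k kc ->] [hc kh] fc hf; split=> //.
exact: (c0equiv_trans sc kc hc fc kh hf).
Qed.

Lemma Gamma_class h : is_c0seq h -> exists2 a, Gamma H a & a h.
Proof.
move=> hc; exists [set f | is_c0seq f /\ c0equiv h f]; first by exists h.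
by split=> //; exact: c0seq_equiv_refl.
Qed.

Lemma Gamma_eq a b h : Gamma H a -> Gamma H b -> a h -> b h -> a = b.
Proof.
suff sub c d : Gamma H c -> Gamma H d -> c h -> d h -> c `<=` d.
  by move=> Ga Gb ah bh; apply/seteqP; split; exact: sub.
move=> Gc Gd ch dh f cf; have fc := Gamma_c0seq Gc cf; have hc := Gamma_c0seq Gc ch.
apply: (Gamma_equiv Gd dh fc).
case: Gc ch cf => k kc -> [_ kh] [_ kf].
exact: (c0equiv_trans sc hc kc fc (c0equiv_sym kh) kf).
Qed.

Lemma incomplete_tensor_linear a : linear_set (incomplete_tensor E a).
Proof. exact: closed_span_linear. Qed.

Lemma incomplete_tensor_closed a : closed (incomplete_tensor E a).
Proof. exact: closed_closure. Qed.

Lemma tens_in_incomplete a h : a h -> incomplete_tensor E a (tens E h).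
Proof. by move=> ah; apply: sub_closed_span; exists h. Qed.

(** A nonzero inner product with a member of the class would make g equivalent
    to that member. *)
Lemma tens_ortho_incomplete a g : Gamma H a -> is_c0seq g -> ~ a g ->
  orthocomp (incomplete_tensor E a) (tens E g).
Proof.
move=> Ga gc ag; apply: orthocomp_closed_span => _ [f af <-].
apply/eqP; apply: contrapT => /negP gf; apply: ag.
have fc := Gamma_c0seq Ga af.
apply: (Gamma_equiv Ga af gc); apply: c0equiv_sym.
by apply: c0equiv_of_hdot_tens gf; [case: gc|case: fc].
Qed.

(** A zero tensor lies in H_a; a nonzero one comes from a C_0-sequence, which is
    either in the class or equivalent to none of its members. *)
Lemma tens_dichotomy a g : Gamma H a -> is_cseq g ->
  incomplete_tensor E a (tens E g) \/ orthocomp (incomplete_tensor E a) (tens E g).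
Proof.
move=> Ga gc; have [g0|g0] := eqVneq (tens E g) 0.
  by left; rewrite g0; exact: (incomplete_tensor_linear a).1.
have [ag|ag] := pselect (a g); first by left; exact: tens_in_incomplete.
by right; apply: tens_ortho_incomplete => //; exact: c0seq_of_tens.
Qed.

Lemma incomplete_tensor_ortho a b : Gamma H a -> Gamma H b -> a <> b ->
  incomplete_tensor E b `<=` orthocomp (incomplete_tensor E a).
Proof.
move=> Ga Gb ab; apply: closed_span_min.
- exact: orthocomp_linear.
- exact: orthocomp_closed.
- move=> _ [f bf <-]; apply: tens_ortho_incomplete => //.
    exact: Gamma_c0seq bf.
  by move=> af; apply: ab; exact: Gamma_eq af bf.
Qed.

Lemma incomplete_tensor_total :
  closure (lin_span (\bigcup_(a : set_type (Gamma H)) incomplete_tensor E (set_val a)))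
  = setT.
Proof.
rewrite -subTset -tens_dense; apply: closed_span_min.
- exact: closed_span_linear.
- exact: closed_closure.
move=> _ [g gc <-]; have [g0|g0] := eqVneq (tens E g) 0.
  by rewrite g0; exact: (closed_span_linear _).1.
have [a Ga ag] := Gamma_class (c0seq_of_tens gc g0).
apply: sub_closed_span; exists (SigSub (mem_set Ga)) => //.
exact: tens_in_incomplete.
Qed.

End tensors.

(** * Bounded operators on closed spans *)

Section bounded_operators.
Context (C : numClosedFieldType) (E : normedModType C).
Implicit Types (A D K : set E) (S : E -> E).

Lemma bounded_operator0 D S : D 0 -> bounded_operator_on D S -> S 0 = 0.
Proof.
move=> D0 [_ Sl _]; have := Sl (-1) 0 0 D0 D0.
by rewrite scaler0 addr0 scaleN1r addNr.
Qed.

Lemma bounded_operator_lipschitz D S : linear_set D -> bounded_operator_on D S ->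
  exists2 M, 0 < M & forall x y, D x -> D y -> `|S x - S y| <= M * `|x - y|.
Proof.
move=> lD [_ Sl [M SM]]; exists (`|M| + 1) => [|x y Dx Dy]; first by rewrite ltr_wpDl.
have -> : S x - S y = S (x - y).
  by rewrite addrC -scaleN1r -Sl// scaleN1r addrC.
have xy : D (x - y) by exact: linear_setB.
apply: le_trans (_ : `|M| * `|x - y| <= _); last by rewrite ler_wpM2r// lerDl.
have Mxy := SM _ xy.
apply: (le_trans Mxy).
by rewrite -[leLHS]ger0_norm ?(le_trans _ Mxy)// normrM normr_id.
Qed.

Lemma bounded_operator_sub D D' S : D' `<=` D -> (forall x, D' x -> D' (S x)) ->
  bounded_operator_on D S -> bounded_operator_on D' S.
Proof.
move=> DD SD [_ Sl [M SM]]; split=> //; first by move=> a x y /DD Dx /DD; exact: Sl.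
by exists M => x /DD; exact: SM.
Qed.

Lemma bounded_operator_image A K S : bounded_operator_on setT S ->
    linear_set K -> closed K -> (forall x, A x -> K (S x)) ->
  forall x, closure (lin_span A) x -> K (S x).
Proof.
move=> bS lK cK AK; suff : closure (lin_span A) `<=` [set x | K (S x)] by [].
have [M M0 SM] := bounded_operator_lipschitz (@linear_setT _ _) bS.
have [_ Sl _] := bS.
apply: closed_span_min => //.
  split=> [|a x y Kx Ky] /=; last by rewrite Sl//; exact: lK.2.
  by rewrite (bounded_operator0 _ bS)//; exact: lK.1.
apply: closed_normP => x xK /=; apply/cK/closure_normP => e e0.
have [y Ky xy] := xK (e / M) (divr_gt0 e0 M0).
exists (S y) => //; apply: le_lt_trans (SM _ _ Logic.I Logic.I) _.
by rewrite mulrC -ltr_pdivlMr.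
Qed.

(** Both operators are linear, hence agree on the span, and Lipschitz, hence
    agree on its closure.  Only values on the closed span are compared, since the
    operators are arbitrary elsewhere. *)
Lemma bounded_operator_unique A S S' :
    bounded_operator_on (closure (lin_span A)) S ->
    bounded_operator_on (closure (lin_span A)) S' ->
    (forall x, A x -> S x = S' x) ->
  forall x, closure (lin_span A) x -> S x = S' x.
Proof.
set D := closure _ => bS bS' SS' x Dx.
have lD : linear_set D := closed_span_linear A.
have [M M0 SM] := bounded_operator_lipschitz lD bS.
have [M' M0' SM'] := bounded_operator_lipschitz lD bS'.
have Ssp y : lin_span A y -> S y = S' y.
  have [[_ Sl _] [_ Sl' _]] := (bS, bS').
  suff : lin_span A `<=` [set y | D y /\ S y = S' y] by move=> + Ay => /(_ y Ay)[].
  apply: lin_span_min => [|z Az]; last by split; [exact: sub_closed_span|exact: SS'].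
  split=> [|a u v [Du Su] [Dv Sv]].
    split; first exact: lD.1.
    by rewrite (bounded_operator0 lD.1 bS) (bounded_operator0 lD.1 bS').
  by split; [exact: lD.2|rewrite Sl// Sl'// Su Sv].
apply/eqP; rewrite -subr_eq0; apply/eqP; apply: (@le_eps_eq0 _ _ _ (M + M')) => e e0.
move/closure_normP : (Dx) => /(_ e e0)[y Ay xy].
have Dy : D y by exact: subset_closure.
have -> : S x - S' x = (S x - S y) - (S' x - S' y).
  by rewrite (Ssp y Ay) opprB addrA subrK.
apply: le_trans (ler_normB _ _) _; rewrite mulrDl; apply: lerD.
  by apply: (le_trans (SM _ _ Dx Dy)); rewrite ler_wpM2l// ltW.
by apply: (le_trans (SM' _ _ Dx Dy)); rewrite ler_wpM2l// ltW.
Qed.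

Lemma bounded_operator_cvg S (T : Type) (F : set_system T) (u : T -> E) (x : E) :
    Filter F -> bounded_operator_on setT S ->
  u @ F --> x -> S \o u @ F --> S x.
Proof.
move=> FF bS /cvgrPdist_lt ux.
have [M M0 SM] := bounded_operator_lipschitz (@linear_setT _ _) bS.
apply/cvgrPdist_lt => e e0; apply: filterS (ux (e / M) (divr_gt0 e0 M0)) => t xu.
apply: le_lt_trans (SM _ _ Logic.I Logic.I) _.
by rewrite mulrC -ltr_pdivlMr.
Qed.

End bounded_operators.

(** * The tensor semigroup *)

(** The times in [0, t] that f sends into K form a closed set, and an open one
    since its complement is where f lies in the closed set L. *)
Lemma segment_path_closed (R : realType) (X : topologicalType) (f : R -> X)
    (K L : set X) (t : R) :
    0 <= t -> {within `[0, t], continuous f} -> closed K -> closed L ->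
    (forall s, 0 <= s <= t -> K (f s) \/ L (f s)) ->
    (forall s, 0 <= s <= t -> K (f s) -> ~ L (f s)) ->
  K (f 0) -> K (f t).
Proof.
move=> t0 /continuous_closedP fc cK cL KL KnL K0.
have inA s : `[0, t]%classic s = (0 <= s <= t) by rewrite /= in_itv.
suff : `[0, t]%classic `&` f @^-1` K = `[0, t]%classic.
  move=> KA; have : `[0, t]%classic t by rewrite inA t0 lexx.
  by rewrite -KA => -[].
have /closed_subspaceP[V cV VK] := fc _ cK.
have /closed_subspaceP[W cW WL] := fc _ cL.
apply: (segment_connected (a := 0) (b := t)).
- by exists 0; split=> //; rewrite inA lexx.
- exists (~` W); first exact: closed_openC.
  apply/seteqP; split=> s [As Ks]; split=> //.
    move=> Ws; have : (W `&` `[0, t]%classic) s by [].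
    by rewrite WL => -[Ls _]; apply: (KnL s _ Ks Ls); rewrite -inA.
  have : K (f s) \/ L (f s) by apply: KL; rewrite -inA.
  case=> // Ls; exfalso; apply: Ks.
  have : (f @^-1` L `&` `[0, t]%classic) s by [].
  by rewrite -WL => -[].
- by exists V => //; rewrite setIC -VK setIC.
Qed.

Section tensor_semigroups.
Context (R : realType) (C : numClosedFieldType) (H : nat -> hilbertType C).
Context (E : complete_tensor H) (T : forall n : nat, R -> H n -> H n).
Context (sc : series_complete C).
Context (C0_T : is_tensor_C0_semigroup E setT T).

Arguments T : clear implicits.

Local Notation S := (tensor_semigroup E setT T).
Local Notation orbit h t := (fun n : nat => T n t (h n)).

Lemma tensor_opP (D : set E) (A : forall n : nat, H n -> H n) :
  tensor_well_defined D A -> tensor_extension D A (tensor_op D A).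
Proof. by move=> [_]; exact: xgetPex. Qed.

Lemma semigroup_bounded t : 0 <= t -> bounded_operator_on setT (S t).
Proof. by move=> t0; have [_ [[bS _ _] _]] := C0_T; exact: bS. Qed.

Lemma semigroup_tens t h : 0 <= t -> is_cseq h ->
  is_cseq (orbit h t) /\ S t (tens E h) = tens E (orbit h t).
Proof.
move=> t0 ch; have [wd _] := C0_T; have [/(_ h ch Logic.I)[cTh _] _] := wd t t0.
by split=> //; exact: (tensor_opP (wd t t0)).2.
Qed.

(** If S(t) kills the tensor there is nothing to prove.  Otherwise the orbit has
    no zero before t, because S(t) = S(t - s) S(s), so on [0, t] it is always in
    exactly one of H_a and its orthogonal complement. *)
Lemma semigroup_tens_invariant a h t : Gamma H a -> a h -> 0 <= t ->
  incomplete_tensor E a (S t (tens E h)).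
Proof.
move=> Ga ah t0; have [ch _] := Gamma_c0seq Ga ah.
set K := incomplete_tensor E a; set x := tens E h.
have [_ [[_ S0 SD] Sc]] := C0_T.
have lK : linear_set K := incomplete_tensor_linear E a.
have [->|St0] := eqVneq (S t x) 0; first exact: lK.1.
have Ss0 s : 0 <= s <= t -> S s x <> 0.
  move=> /andP[s0 st] Ss; move/eqP : St0; apply.
  rewrite -(subrK s t) SD// ?subr_ge0// Ss.
  by apply: bounded_operator0 (semigroup_bounded _); rewrite ?subr_ge0.
apply: (@segment_path_closed _ _ (fun s => S s x) K (orthocomp K) t) => //.
- apply: continuous_subspaceW (Sc x Logic.I) => s.
  by rewrite /= !in_itv/= andbT => /andP[].
- exact: incomplete_tensor_closed.
- exact: orthocomp_closed.
- move=> s /andP[s0 _]; have [cTh ->] := semigroup_tens s0 ch.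
  exact: tens_dichotomy.
- move=> s /Ss0 Ss Ks /(_ _ Ks)/eqP.
  by rewrite -hdot_norm expf_eq0/= normr_eq0 => /eqP.
- by rewrite S0//; exact: tens_in_incomplete.
Qed.

Lemma semigroup_invariant a t x : Gamma H a -> 0 <= t ->
  incomplete_tensor E a x -> incomplete_tensor E a (S t x).
Proof.
move=> Ga t0; move: x; apply: bounded_operator_image.
- exact: semigroup_bounded.
- exact: incomplete_tensor_linear.
- exact: incomplete_tensor_closed.
- by move=> _ [h ah <-]; exact: semigroup_tens_invariant.
Qed.

(** The operator S(t) itself extends the factorwise map, by invariance. *)
Lemma restricted_well_defined a t : Gamma H a -> 0 <= t ->
  tensor_well_defined (incomplete_tensor E a) (fun n => T n t).
Proof.
move=> Ga t0; split=> [h ch hK|].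
  have [cTh ST] := semigroup_tens t0 ch.
  by split=> //; rewrite -ST; exact: semigroup_invariant.
exists (S t); split; last by move=> h ch _; exact: (semigroup_tens t0 ch).2.
apply: bounded_operator_sub (semigroup_bounded t0) => //.
by move=> x; exact: semigroup_invariant.
Qed.

Lemma restricted_semigroupE a t x : Gamma H a -> 0 <= t ->
  incomplete_tensor E a x -> tensor_semigroup E (incomplete_tensor E a) T t x = S t x.
Proof.
move=> Ga t0; move: x; have [bS' S'T] := tensor_opP (restricted_well_defined Ga t0).
apply: bounded_operator_unique => //.
  apply: bounded_operator_sub (semigroup_bounded t0) => //.
  by move=> x; exact: semigroup_invariant.
move=> _ [h ah <-]; have [ch _] := Gamma_c0seq Ga ah.
by rewrite (semigroup_tens t0 ch).2 -S'T//; exact: tens_in_incomplete.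
Qed.

Lemma restricted_C0_semigroup a : Gamma H a ->
  is_tensor_C0_semigroup E (incomplete_tensor E a) T.
Proof.
move=> Ga; have [_ [[_ S0 SD] Sc]] := C0_T.
split; first by move=> t; exact: restricted_well_defined.
split; first split.
- by move=> t t0; exact: (tensor_opP (restricted_well_defined Ga t0)).1.
- by move=> x Kx; rewrite restricted_semigroupE// S0.
- move=> s t x s0 t0 Kx; rewrite !restricted_semigroupE ?addr_ge0// ?SD//.
  exact: semigroup_invariant.
move=> x Kx; apply: subspace_eq_continuous (Sc x Logic.I) => s.
rewrite mem_setE in_itv/= andbT => s0.
exact: (esym (restricted_semigroupE Ga s0 Kx)).
Qed.

(** S(t) commutes with the unconditional sum of the projections because it is
    bounded. *)
Lemma semigroup_direct_sum t : 0 <= t ->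
  is_direct_sum_operator
    (fun a : set_type (Gamma H) => incomplete_tensor E (set_val a))
    (fun a : set_type (Gamma H) =>
       tensor_semigroup E (incomplete_tensor E (set_val a)) T t)
    (S t).
Proof.
move=> t0.
have GP (a : set_type (Gamma H)) : Gamma H (set_val a) by exact: set_valP.
have Ko (a b : set_type (Gamma H)) : a != b ->
    incomplete_tensor E (set_val b) `<=` orthocomp (incomplete_tensor E (set_val a)).
  move=> ab; apply: incomplete_tensor_ortho => // /val_inj /eqP.
  exact/negP.
split=> [a b u v ab Ku Kv|y].
  by apply: Ko Ku _ Kv; rewrite eq_sym.
have [x [Kx xy]] := orthogonal_decomposition
  (fun a : set_type (Gamma H) => incomplete_tensor_linear E (set_val a))
  (fun a => @incomplete_tensor_closed _ _ E (set_val a)) Ko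
  (incomplete_tensor_total E sc) y.
exists x; split=> //.
rewrite /has_sum (_ : summability.partial_sum _ = S t \o summability.partial_sum x).
  exact: bounded_operator_cvg (semigroup_bounded t0) xy.
apply/funext => J; rewrite /summability.partial_sum/=.
have [_ Sl _] := semigroup_bounded t0.
have SD u v : S t (u + v) = S t u + S t v by rewrite -[u]scale1r Sl// !scale1r.
have S00 : S t 0 = 0 by apply: bounded_operator0 (semigroup_bounded t0).
rewrite (big_morph _ SD S00); apply: eq_bigr => a _.
exact: restricted_semigroupE.
Qed.

End tensor_semigroups.

Theorem theorem6p17 (R : realType) (H : nat -> hilbertType R[i])
    (E : complete_tensor H) (T : forall n : nat, R -> H n -> H n)
    (semigroup_T : forall n : nat, semigroup_on setT (T n))
    (C0_T : is_tensor_C0_semigroup E setT T) :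
  [/\ forall a : set (forall n : nat, H n), Gamma H a ->
        forall (t : R) (x : E), 0 <= t ->
          incomplete_tensor E a x ->
          incomplete_tensor E a (tensor_semigroup E setT T t x),
      forall a : set (forall n : nat, H n), Gamma H a ->
        is_tensor_C0_semigroup E (incomplete_tensor E a) T /\
        forall (t : R) (x : E), 0 <= t -> incomplete_tensor E a x ->
          tensor_semigroup E (incomplete_tensor E a) T t x =
          tensor_semigroup E setT T t x
    & forall t : R, 0 <= t ->
        is_direct_sum_operator
          (fun a : set_type (Gamma H) => incomplete_tensor E (set_val a))
          (fun a : set_type (Gamma H) =>
             tensor_semigroup E (incomplete_tensor E (set_val a)) T t)
          (tensor_semigroup E setT T t)].
Proof.
have sc := @complex_series_complete R.
split=> [a Ga t x|a Ga|t].
- exact: semigroup_invariant.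
- split; first exact: restricted_C0_semigroup.
  by move=> t x; exact: restricted_semigroupE.
- exact: semigroup_direct_sum.
Qed.
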